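(* The unique non-trivial indecomposable Foulkes module is $H^{(2^2)}$ in characteristic $p=3$. That is, for an odd prime $p$, a field $F$ of characteristic $p$ and $n\in\mathbf{N}$, the $FS_{2n}$-module $H^{(2^n)}$ is indecomposable and not the trivial module if and only if $n=2$ and $p=3$.
   Context: The Foulkes module $H^{(2^n)}$ is the permutation module over $F$ of $S_{2n}$ acting on the set partitions of $\{1,\ldots,2n\}$ into $n$ sets of size $2$. (For $n=1$ it is the trivial module.) *)

(* Defs.v *)
From mathcomp Require Import all_boot all_fingroup all_algebra.
From mathcomp Require Import mxrepresentation.

Set Implicit Arguments.
Unset Strict Implicit.
Unset Printing Implicit Defensive.

Import GroupScope GRing.Theory.
Local Open Scope ring_scope.

(* Modules are right modules of row vectors, as in mxrepresentation, and
   permutations of 'I_m compose from left to right. *)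

Section PermutationModule.

Variables (F : fieldType) (gT : finGroupType) (G : {group gT}).
Variables (T : finType) (to : {action gT &-> T}) (S : {set T}).

(* The basis vector indexed by x \in S is sent by g to the one indexed by
   to x g. *)
Definition permmod_mx (g : gT) : 'M[F]_#|S| :=
  \matrix_(i, j) (to (enum_val i) g == enum_val j)%:R.

Hypothesis actsGS : [acts G, on S | to].

Lemma permmod_mx_repr : mx_repr G permmod_mx.
Proof.
split=> [|g h Gg Gh]; apply/matrixP=> i j.
  by rewrite !mxE act1 (inj_eq enum_val_inj).
have Sig : to (enum_val i) g \in S.
  by rewrite (acts_act actsGS Gg) enum_valP.
rewrite !mxE (bigD1 (enum_rank_in Sig (to (enum_val i) g))) //=.
rewrite !mxE enum_rankK_in // eqxx mul1r -actM big1 ?addr0 // => k ne_k.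
rewrite !mxE; case: eqP => [eq_k|_]; last by rewrite mul0r.
by case/eqP: ne_k; apply: enum_val_inj; rewrite enum_rankK_in.
Qed.

Definition permmod_repr : mx_representation F G #|S| :=
  MxRepresentation permmod_mx_repr.

End PermutationModule.

Section Modules.

Variables (F : fieldType) (gT : finGroupType) (G : {group gT}).

Lemma triv_mx_repr : mx_repr G (fun _ : gT => 1%:M : 'M[F]_1).
Proof. by split=> // g h _ _; rewrite mulmx1. Qed.

Definition triv_repr : mx_representation F G 1 := MxRepresentation triv_mx_repr.

Definition mx_trivial n (rG : mx_representation F G n) : Prop :=
  mx_rsim rG triv_repr.

Definition mx_indecomposable n (rG : mx_representation F G n) : Prop :=
  (0 < n)%N /\
  forall U V : 'M[F]_n, mxmodule rG U -> mxmodule rG V ->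
    (U + V :=: 1%:M)%MS -> (U :&: V)%MS = 0 -> U = 0 \/ V = 0.

End Modules.

Definition pair_partitions (n : nat) : {set {set {set 'I_(2 * n)}}} :=
  [set P : {set {set 'I_(2 * n)}} |
    [&& partition P [set: 'I_(2 * n)], #|P| == n
      & [forall B in P, #|B| == 2]]].

(* The natural action 'P on points, lifted to blocks and then to sets of
   blocks. *)
Definition set_of_sets_action (n : nat) :
    {action {perm 'I_(2 * n)} &-> {set {set 'I_(2 * n)}}} :=
  (('P^*)^*)%act.

Lemma pair_partitions_acts n :
  [acts [set: 'S_(2 * n)], on pair_partitions n | set_of_sets_action n].
Proof.
have stab (s : 'S_(2 * n)) P : P \in pair_partitions n ->
    set_of_sets_action n P s \in pair_partitions n.
  rewrite !inE => /and3P[partP cardP /forall_inP cardB].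
  apply/and3P; split.
  - have imT : s @: [set: 'I_(2 * n)] = [set: 'I_(2 * n)].
      by apply/eqP; rewrite eqEcard subsetT card_imset ?leqnn; last exact: perm_inj.
    by move: partP; rewrite -(imset_partition _ _ (@perm_inj _ s)) imT.
  - by rewrite card_setact.
  - by apply/forall_inP=> _ /imsetP[B PB ->]; rewrite card_setact cardB.
apply/actsP=> s _ P; apply/idP/idP; last exact: stab.
by move/(stab s^-1%g); rewrite actK.
Qed.

(* H^(2^n), as a module for the full symmetric group on 'I_(2 * n). *)
Definition foulkes_repr (F : fieldType) (n : nat) :
    mx_representation F [set: 'S_(2 * n)]%G #|pair_partitions n| :=
  permmod_repr F (pair_partitions_acts n).

(* Main.v *)
(* Let D be the sum of the operators of all transpositions (i j), over ordered
   pairs, on H^(2^n). It is a module endomorphism, and it acts on functions on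
   the set of perfect matchings. Write m = 2n and x_ab for the indicator
   function of the matchings containing the edge ab. Then D 1 = m^2,
     D x_ab = (m-2)^2 x_ab + 4,
     D (x_ab x_cd) = (m-4)^2 x_ab x_cd + 4 (x_ab + x_cd)
                     + 4 (x_ac x_bd + x_ad x_bc).
   If m <> 1 in F and n >= 2, then x_ab - 1/(m-1) is an eigenfunction for
   (m-2)^2 <> m^2. If m = 1 in F and n >= 3, then
     x_ab x_cd - x_ac x_bd + x_ab + x_cd - x_ac - x_bd
   is a nonzero eigenfunction for 5 <> m^2 = 1. An endomorphism with two
   distinct eigenvalues in F splits the module. The only case left is n = 2
   with p | 2n - 1 = 3, where an element of order 3 permutes the 3 matchings
   cyclically, so that every nonzero submodule contains the all-ones vector. *)

Require Import Defs.
From mathcomp Require Import all_boot all_fingroup all_algebra.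
From mathcomp Require Import mxrepresentation.
From mathcomp Require Import ring.

Set Implicit Arguments.
Unset Strict Implicit.
Unset Printing Implicit Defensive.

Import GRing.Theory.
Local Open Scope ring_scope.

(** * Splitting a module by two eigenvalues of an endomorphism *)

Section Decomposition.

Variables (F : fieldType).

Lemma horner_mx_eigencol n (D : 'M[F]_n.+1) (q : {poly F}) (h : 'cV[F]_n.+1) a :
  D *m h = a *: h -> horner_mx D q *m h = q.[a] *: h.
Proof.
move=> Dh; elim/poly_ind: q => [|q c IHq].
  by rewrite rmorph0 horner0 mul0mx scale0r.
rewrite rmorphD rmorphM /= horner_mx_C horner_mx_X mulmxDl -mulmxA Dh -scalemxAr IHq.
by rewrite mul_scalar_mx !hornerE scalerA -scalerDl mulrC.
Qed.

(** The kernel consists of rows while [h] is a column: [q(D)] kills [h], so it is singular and its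
    left kernel is nonzero too. *)
Lemma kermxpoly_neq0 n (D : 'M[F]_n) (q : {poly F}) (h : 'cV[F]_n) a :
  D *m h = a *: h -> h != 0 -> q.[a] = 0 -> kermxpoly D q != 0.
Proof.
case: n => [|n] in D h *; first by rewrite (flatmx0 h) eqxx.
move=> Dh nz_h qa0; apply: contraNneq nz_h => /eqP; rewrite kermx_eq0 row_free_unit.
move=> Uq; rewrite -(mulKmx Uq h) (horner_mx_eigencol _ Dh) qa0 scale0r.
by rewrite mulmx0.
Qed.

(** Write the characteristic polynomial as [(X - a)^e q] with [q(a) != 0]. By Cayley-Hamilton the
    kernels of the two coprime factors at [D] are complementary submodules. The root [a] belongs to
    the first factor and [b] to [q], so neither kernel is zero. *)
Lemma two_eigenvalues_decomposable (gT : finGroupType) (G : {group gT}) n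
    (rG : mx_representation F G n) (D : 'M[F]_n) (h k : 'cV[F]_n) a b :
  {in G, forall g, comm_mx D (rG g)} ->
  D *m h = a *: h -> h != 0 -> D *m k = b *: k -> k != 0 -> a != b ->
  ~ mx_indecomposable rG.
Proof.
move=> cDG Dh nz_h Dk nz_k neq_ab [n_gt0 indec].
have mod_ker q : mxmodule rG (kermxpoly D q).
  by apply/mxmoduleP=> g Gg; apply: comm_mx_stable_kermxpoly; apply: cDG.
case: n => // n in rG D h k cDG Dh nz_h Dk nz_k n_gt0 indec mod_ker *.
have [e [q]] := multiplicity_XsubC (char_poly D) a.
rewrite monic_neq0 ?char_poly_monic //= => nr_qa Dp.
have cop : coprimep (('X - a%:P) ^+ e) q.
  by rewrite coprimep_expl // coprimep_sym coprimep_XsubC.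
have eig0 (v : 'cV_n.+1) c : D *m v = c *: v -> v != 0 -> (char_poly D).[c] = 0.
  move=> Dv nz_v; apply/eqP; apply: contraNT nz_v => nz_pc.
  have := horner_mx_eigencol (char_poly D) Dv.
  rewrite Cayley_Hamilton mul0mx => /esym/eqP.
  by rewrite scaler_eq0 (negPf nz_pc).
have := indec _ _ (mod_ker (('X - a%:P) ^+ e)) (mod_ker q).
case.
- apply: eqmx_trans (eqmx_sym (kermxpolyM D cop)) _.
  by rewrite mulrC -Dp; apply: kermxpoly_min; apply: mxminpoly_dvd_char.
- exact: mxdirect_kermxpoly.
- apply/eqP; apply: (kermxpoly_neq0 Dh nz_h).
  have /eqP := eig0 _ _ Dh nz_h; rewrite Dp hornerM mulf_eq0 => /orP[|/eqP//].
  by rewrite -rootE (negPf nr_qa).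
- apply/eqP; apply: (kermxpoly_neq0 Dk nz_k).
  have /eqP := eig0 _ _ Dk nz_k; rewrite Dp hornerM mulf_eq0 => /orP[/eqP//|].
  by rewrite horner_exp expf_eq0 !hornerE subr_eq0 eq_sym (negPf neq_ab) andbF.
Qed.

End Decomposition.

(** * Transposition sums for the edge indicator of an abstract perfect matching *)

Section TranspositionSums.

Variables (F : fieldType) (T : finType).

Lemma sum_notin_seq (s : seq T) (f : T -> F) :
  uniq s -> \sum_(i | i \notin s) f i = \sum_i f i - \sum_(i <- s) f i.
Proof.
by move=> us; rewrite [in RHS](bigID (mem s)) /= -big_uniq // addrAC subrr add0r.
Qed.

(** Here [f i j] is a monomial after swapping [i] and [j], and [s] lists its points. Pairs outside
    [s] leave it equal to [c]; mixed pairs count twice by symmetry. The mixed part uses full sums of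
    [g] minus sums over [s], so that row sums can be evaluated. *)
Lemma sum_pairs_split (s : seq T) (f g : T -> T -> F) (c : F) :
    uniq s -> (forall i j, f i j = f j i) ->
    {in predC (mem s) &, forall i j, f i j = c} ->
    {in s & predC (mem s), forall i j, f i j = g i j} ->
  \sum_i \sum_j f i j =
    (#|T|%:R - (size s)%:R) ^+ 2 * c
    + 2 * (\sum_(i <- s) (\sum_j g i j - \sum_(j <- s) g i j))
    + \sum_(i <- s) \sum_(j <- s) f i j.
Proof.
move=> us f_sym fc fg.
have big_in (h : T -> F) : \sum_(i in s) h i = \sum_(i <- s) h i by rewrite big_uniq.
have splitj i : \sum_j f i j = \sum_(j <- s) f i j + \sum_(j | j \notin s) f i j.
  by rewrite (bigID (mem s)) /= big_uniq.
have cross : \sum_(i <- s) \sum_(j | j \notin s) f i j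
    = \sum_(i <- s) (\sum_j g i j - \sum_(j <- s) g i j).
  apply: eq_big_seq => i si; rewrite -sum_notin_seq //.
  by apply: eq_bigr => j sj; apply: fg.
have cross' : \sum_(i | i \notin s) \sum_(j <- s) f i j
    = \sum_(i <- s) \sum_(j | j \notin s) f i j.
  by rewrite exchange_big; apply: eq_bigr => j _; apply: eq_bigr => i _; rewrite f_sym.
have outer : \sum_(i | i \notin s) \sum_(j | j \notin s) f i j
    = (#|T|%:R - (size s)%:R) ^+ 2 * c.
  have const (x : F) : \sum_(i | i \notin s) x = (#|T|%:R - (size s)%:R) * x.
    rewrite sum_notin_seq // sumr_const big_const_seq count_predT iter_addr_0.
    by rewrite mulrBl !mulr_natl.
  rewrite expr2 -mulrA -!const; apply: eq_bigr => i si.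
  by apply: eq_bigr => j sj; apply: fc.
rewrite (eq_bigr _ (fun i _ => splitj i)) big_split /=.
rewrite (bigID (mem s) predT) /= big_in cross' [X in _ + X](bigID (mem s)) /= big_in.
by rewrite outer cross; ring.
Qed.

Variable (x : T -> T -> F).
Hypothesis xC : forall a b, x a b = x b a.
Hypothesis x_row : forall a, \sum_b x a b = 1.
Hypothesis x_diag : forall a, x a a = 0.
Hypothesis x_excl : forall a b c, b != c -> x a b * x a c = 0.

Let x_col b : \sum_a x a b = 1.
Proof. by rewrite -(x_row b); apply: eq_bigr => a _; apply: xC. Qed.

(** The mixed pairs contribute [4 - 4 x_ab], and the four pairs inside [{a, b}] restore [4 x_ab]. *)
Lemma sum_tperm_edge a b : a != b ->
  \sum_i \sum_j x (tperm i j a) (tperm i j b) = (#|T|%:R - 2) ^+ 2 * x a b + 4.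
Proof.
move=> ab; have ba : b != a by rewrite eq_sym.
rewrite (@sum_pairs_split [:: a; b] _
  (fun i j => if i == a then x j b else x a j) (x a b)) /=; first last.
- move=> i j; rewrite !inE negb_or => /orP[]/eqP-> /andP[ja jb].
    by rewrite eqxx tpermL tpermD.
  by rewrite (negPf ba) tpermL tpermD // eq_sym.
- by move=> i j; rewrite !inE !negb_or => /andP[ia ib] /andP[ja jb]; rewrite !tpermD.
- by move=> i j; rewrite tpermC.
- by rewrite inE ab.
rewrite !big_cons !big_nil /= ?eqxx ?(negPf ba) x_row x_col.
rewrite !tperm1 !perm1 !tpermL !tpermR !x_diag (xC b a).
ring.
Qed.

(** Products of edges sharing one point vanish, so the mixed pairs give
    [4 (x_ab + x_cd) - 8 x_ab x_cd]. Of the 16 inner pairs, eight preserve the monomial and cancel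
    the [-8]; the others give each of the two remaining matchings of the four points four times. *)
Lemma sum_tperm_edge2 a b c d : uniq [:: a; b; c; d] ->
  \sum_i \sum_j x (tperm i j a) (tperm i j b) * x (tperm i j c) (tperm i j d)
  = (#|T|%:R - 4) ^+ 2 * (x a b * x c d) + 4 * (x a b + x c d)
    + 4 * (x a c * x b d + x a d * x b c).
Proof.
move=> uabcd; have := uabcd.
rewrite /= !inE !negb_or andbT => /and3P[/and3P[ab ac ad] /andP[bc bd] cd].
have [ba ca da] : [/\ b != a, c != a & d != a] by rewrite ![_ == a]eq_sym.
have [cb db dc] : [/\ c != b, d != b & d != c].
  by rewrite (eq_sym c b) !(eq_sym d).
rewrite (@sum_pairs_split [:: a; b; c; d] _
  (fun i j => if i == a then x j b * x c d else if i == b then x a j * x c d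
     else if i == c then x a b * x j d else x a b * x c j)
  (x a b * x c d)) //; first last.
- move=> i j; rewrite !inE !negb_or => /or4P[]/eqP-> /and4P[ja jb jc jd];
  by rewrite ?eqxx ?(negPf ba) ?(negPf ca) ?(negPf da) ?(negPf cb) ?(negPf db)
    ?(negPf dc) tpermL ?tpermD // eq_sym.
- move=> i j; rewrite !inE !negb_or => /and4P[ia ib ic id] /and4P[ja jb jc jd].
  by rewrite !tpermD.
- by move=> i j; rewrite tpermC.
rewrite !big_cons !big_nil ?eqxx ?(negPf ba) ?(negPf ca) ?(negPf da) ?(negPf cb)
  ?(negPf db) ?(negPf dc) -?mulr_suml -?mulr_sumr !x_row !x_col.
rewrite !tperm1 !perm1 !tpermL !tpermR.
rewrite ?[tperm _ _ a]tpermD ?[tperm _ _ b]tpermD ?[tperm _ _ c]tpermD ?[tperm _ _ d]tpermD //.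
have xmid u v w : u != w -> x u v * x v w = 0 by rewrite (xC u v); apply: x_excl.
have xrig u v w : u != w -> x u v * x w v = 0.
  by rewrite (xC u v) (xC w v); apply: x_excl.
rewrite (xC b a) (xC c a) (xC c b) (xC d b) (xC d c) !x_diag /=.
rewrite (xmid b c d) // (xrig b d c) // (xmid a c d) // (xrig a d c) //.
rewrite (@x_excl a b d) // (xmid a b d) // (@x_excl a b c) // (xmid a b c) //.
ring.
Qed.

End TranspositionSums.

(** * Functions on the permuted set as column vectors *)

Section PermutationModules.

Variables (F : fieldType) (gT : finGroupType) (G : {group gT}).
Variables (T : finType) (to : {action gT &-> T}) (S : {set T}).
Hypothesis actsGS : [acts G, on S | to].

(** Module elements are rows, so columns are functions on the basis [S], on which [g] acts by
    precomposition. *)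
Definition colfun (f : T -> F) : 'cV[F]_#|S| := \col_i f (enum_val i).

Lemma colfun_neq0 f x : x \in S -> f x != 0 -> colfun f != 0.
Proof.
move=> Sx; apply: contraNneq => /colP/(_ (enum_rank_in Sx x)).
by rewrite !mxE enum_rankK_in // => ->.
Qed.

Lemma permmod_colfun f g : g \in G ->
  permmod_repr F actsGS g *m colfun f = colfun (fun x => f (to x g)).
Proof.
move=> Gg; apply/colP=> i; rewrite !mxE.
have Sig : to (enum_val i) g \in S by rewrite (acts_act actsGS Gg) enum_valP.
rewrite (bigD1 (enum_rank_in Sig (to (enum_val i) g))) //= !mxE enum_rankK_in //.
rewrite eqxx mul1r big1 ?addr0 // => j ne_j; rewrite !mxE.
case: eqP => [eq_j|_]; last by rewrite mul0r.
by case/eqP: ne_j; apply: enum_val_inj; rewrite enum_rankK_in.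
Qed.

Lemma permmod_row (u : 'rV[F]_#|S|) g i j :
  to (enum_val i) g = enum_val j -> (u *m permmod_repr F actsGS g) 0 j = u 0 i.
Proof.
move=> eq_ij; rewrite !mxE (bigD1 i) //= !mxE eq_ij eqxx mulr1 big1 ?addr0 //.
move=> k ne_ki; rewrite !mxE -eq_ij (inj_eq (act_inj to g)) (inj_eq enum_val_inj).
by rewrite (negPf ne_ki) mulr0.
Qed.

Lemma permmod_trivial : #|S| = 1%N -> mx_trivial (permmod_repr F actsGS).
Proof.
move=> S1; apply: (@MxReprSim _ _ _ _ _ _ _ (const_mx 1)) => //.
  rewrite S1 (_ : const_mx 1 = 1%:M) ?row_free_unit ?unitmx1 //.
  by apply/matrixP=> i j; rewrite !mxE !ord1.
move=> g Gg; rewrite mulmx1.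
have -> : const_mx 1 = colfun (fun=> 1) by apply/colP=> i; rewrite !mxE.
exact: permmod_colfun.
Qed.

End PermutationModules.

(** * Blocks and edges of a perfect matching *)

Section Blocks.

Variables (n : nat) (P : {set {set 'I_(2 * n)}}).
Hypothesis ppP : P \in pair_partitions n.

Let partP : partition P [set: 'I_(2 * n)].
Proof. by move: ppP; rewrite inE => /and3P[]. Qed.

Let trivP : trivIset P. Proof. by case/and3P: partP. Qed.

Lemma card_pair_partition : #|P| = n.
Proof. by move: ppP; rewrite inE => /and3P[_ /eqP]. Qed.

Lemma card_block B : B \in P -> #|B| = 2%N.
Proof. by move: ppP; rewrite inE => /and3P[_ _ /forall_inP cP] /cP/eqP. Qed.

Lemma pair_partition_partner a :
  exists2 b, a != b & [set a; b] \in P.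
Proof.
have Pa : a \in cover P by rewrite (cover_partition partP) inE.
have PB := pblock_mem Pa.
have /eqP/cards2P[b [c [bc eB]]] := card_block PB.
have := Pa; rewrite -mem_pblock eB => /set2P[]ea.
  by exists c; rewrite ea // -eB.
by exists b; rewrite ea 1?eq_sym // setUC -eB.
Qed.

Lemma edge_diff_blocks B C a b :
  B \in P -> C \in P -> B != C -> a \in B -> b \in C -> [set a; b] \notin P.
Proof.
move=> PB PC neBC Ba Cb; apply: contra neBC => Pab.
rewrite -(def_pblock trivP PB Ba) -(def_pblock trivP PC Cb).
by rewrite !(def_pblock trivP Pab) ?set21 ?set22.
Qed.

Lemma diff_blocks_neq B C a b :
  B \in P -> C \in P -> B != C -> a \in B -> b \in C -> a != b.
Proof.
move=> PB PC neBC Ba Cb; apply: contraNneq neBC => eq_ab.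
by rewrite -(def_pblock trivP PB Ba) eq_ab (def_pblock trivP PC Cb).
Qed.

Lemma edge_inj a b c : [set a; b] \in P -> [set a; c] \in P -> b = c.
Proof.
move=> Pab Pac; have eq_abc : [set a; b] = [set a; c].
  by rewrite -(def_pblock trivP Pab (set21 a b)) (def_pblock trivP Pac (set21 a c)).
have : b \in [set a; c] by rewrite -eq_abc set22.
case/set2P=> // eq_ba; have := card_block Pab.
by rewrite eq_ba setUid cards1.
Qed.

Lemma edge_diag a : [set a; a] \notin P.
Proof. by apply/negP=> /card_block; rewrite setUid cards1. Qed.

End Blocks.

Lemma edge_act n (P : {set {set 'I_(2 * n)}}) (s : 'S_(2 * n)) a b :
  ([set a; b] \in set_of_sets_action n P s) = ([set s^-1%g a; s^-1%g b] \in P).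
Proof.
rewrite -[in LHS](permKV s a) -[in LHS](permKV s b).
have -> : [set s (s^-1%g a); s (s^-1%g b)] = ('P^*)%act [set s^-1%g a; s^-1%g b] s.
  by rewrite /= setactE imsetU1 imset_set1.
by rewrite /= setactE mem_imset //; apply: act_inj.
Qed.

(** * The central operator [D] *)

Section TranspositionOperator.

Variables (F : fieldType) (n : nat).

(** As [tperm i i] is the identity, this is [2n] times the identity plus twice the class sum of the
    transpositions. *)
Definition tperm_sum : 'M[F]_#|pair_partitions n| :=
  \sum_i \sum_j foulkes_repr F n (tperm i j).

(** Conjugation by [g] only relabels the pairs [(i, j)]. *)
Lemma tperm_sum_central g : comm_mx tperm_sum (foulkes_repr F n g).
Proof.
rewrite /comm_mx /tperm_sum mulmx_suml mulmx_sumr; apply: esym.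
rewrite (reindex_inj (@perm_inj _ g)); apply: eq_bigr => i _.
rewrite mulmx_suml mulmx_sumr (reindex_inj (@perm_inj _ g)).
by apply: eq_bigr => j _; rewrite -!repr_mxM ?inE // -tpermJ -conjgC.
Qed.

Lemma tperm_sum_eigencol (f : {set {set 'I_(2 * n)}} -> F) c :
    (forall P, P \in pair_partitions n ->
      \sum_i \sum_j f (set_of_sets_action n P (tperm i j)) = c * f P) ->
  tperm_sum *m colfun (pair_partitions n) f = c *: colfun (pair_partitions n) f.
Proof.
move=> eig_f; apply/colP=> k; rewrite [RHS]mxE [in RHS]mxE -(eig_f _ (enum_valP k)).
rewrite mulmx_suml summxE; apply: eq_bigr => i _.
rewrite mulmx_suml summxE; apply: eq_bigr => j _.
by rewrite permmod_colfun ?inE // mxE.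
Qed.

End TranspositionOperator.

(** * Edge indicators of a matching and the action of [D] on them *)

Section Edges.

Variables (F : fieldType) (n : nat).

Definition edge (P : {set {set 'I_(2 * n)}}) a b : F := ([set a; b] \in P)%:R.

Lemma edgeC P a b : edge P a b = edge P b a.
Proof. by rewrite /edge setUC. Qed.

Lemma edge_tperm P i j a b :
  edge (set_of_sets_action n P (tperm i j)) a b
  = edge P (tperm i j a) (tperm i j b).
Proof. by rewrite /edge edge_act tpermV. Qed.

Variable P : {set {set 'I_(2 * n)}}.
Hypothesis ppP : P \in pair_partitions n.

Lemma edge_row a : \sum_b edge P a b = 1.
Proof.
have [b _ Pab] := pair_partition_partner ppP a.
rewrite (bigD1 b) //= big1 => [|c ne_cb]; first by rewrite /edge Pab addr0.
rewrite /edge; case: (boolP (_ \in P)) => // Pac.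
by rewrite (edge_inj ppP Pac Pab) eqxx in ne_cb.
Qed.

Lemma edge_diag0 a : edge P a a = 0.
Proof. by rewrite /edge (negPf (edge_diag ppP a)). Qed.

Lemma edge_mul0 a b c : b != c -> edge P a b * edge P a c = 0.
Proof.
rewrite /edge; case: (boolP (_ \in P)) => [Pab|]; last by rewrite mul0r.
case: (boolP (_ \in P)) => [Pac|]; last by rewrite mulr0.
by rewrite (edge_inj ppP Pab Pac) eqxx.
Qed.

Lemma tperm_sum_edge a b : a != b ->
  \sum_i \sum_j edge (set_of_sets_action n P (tperm i j)) a b
  = ((2 * n)%:R - 2) ^+ 2 * edge P a b + 4.
Proof.
move=> ab; rewrite -[in (2 * n)%:R](card_ord (2 * n)).
rewrite -(sum_tperm_edge (edgeC P) edge_row edge_diag0) //.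
by apply: eq_bigr => i _; apply: eq_bigr => j _; apply: edge_tperm.
Qed.

Lemma tperm_sum_edge2 a b c d : uniq [:: a; b; c; d] ->
  \sum_i \sum_j (edge (set_of_sets_action n P (tperm i j)) a b
                 * edge (set_of_sets_action n P (tperm i j)) c d)
  = ((2 * n)%:R - 4) ^+ 2 * (edge P a b * edge P c d)
    + 4 * (edge P a b + edge P c d)
    + 4 * (edge P a c * edge P b d + edge P a d * edge P b c).
Proof.
move=> uabcd; rewrite -[in (2 * n)%:R](card_ord (2 * n)).
rewrite -(sum_tperm_edge2 (edgeC P) edge_row edge_diag0 edge_mul0) //.
by apply: eq_bigr => i _; apply: eq_bigr => j _; rewrite !edge_tperm.
Qed.

End Edges.

(** * Decomposability from a second eigenvalue *)

Section FoulkesDecomposable.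

Variables (F : fieldType) (n : nat).
Hypothesis two_neq0 : 2%:R != 0 :> F.

Let m : F := (2 * n)%:R.

Lemma sum_ord2_const (x : F) :
  \sum_(i < 2 * n) \sum_(j < 2 * n) x = m ^+ 2 * x.
Proof.
under eq_bigr do rewrite sumr_const card_ord.
by rewrite sumr_const card_ord -mulrnA mulnn -mulr_natl natrX.
Qed.

Lemma tperm_sum_const :
  tperm_sum F n *m colfun (pair_partitions n) (fun=> 1)
  = m ^+ 2 *: colfun (pair_partitions n) (fun=> 1).
Proof. by apply: tperm_sum_eigencol => P _; rewrite sum_ord2_const. Qed.

(** The constant function already has eigenvalue [m^2], so one eigenfunction with another eigenvalue
    is enough. *)
Lemma foulkes_decomposable_of_eigencol f c P :
    P \in pair_partitions n -> f P != 0 -> m ^+ 2 != c ->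
    (forall P, P \in pair_partitions n ->
      \sum_i \sum_j f (set_of_sets_action n P (tperm i j)) = c * f P) ->
  ~ mx_indecomposable (foulkes_repr F n).
Proof.
move=> ppP nz_fP ne_c /tperm_sum_eigencol Df.
apply: two_eigenvalues_decomposable tperm_sum_const _ Df _ ne_c.
- by move=> g _; apply: tperm_sum_central.
- by apply: (@colfun_neq0 _ _ _ _ P) => //; apply: oner_neq0.
- exact: (@colfun_neq0 _ _ _ _ P).
Qed.

Lemma foulkes_decomposable_generic :
  (1 < n)%N -> m - 1 != 0 -> ~ mx_indecomposable (foulkes_repr F n).
Proof.
(* Indecomposability includes being nonzero, so a matching exists. Taking [a] and [b] in different
   blocks of it makes [x_ab] vanish there, and the eigenfunction has the nonzero value
   [-1/(m-1)]. *)
move=> n_gt1 nz_m1 indec; case: (indec) => /card_gt0P[P ppP] _.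
have /card_gt1P[B [C [PB PC neBC]]] : (1 < #|P|)%N by rewrite (card_pair_partition ppP).
have /card_gt0P[a Ba] : (0 < #|B|)%N by rewrite (card_block ppP PB).
have /card_gt0P[b Cb] : (0 < #|C|)%N by rewrite (card_block ppP PC).
have nPab := edge_diff_blocks ppP PB PC neBC Ba Cb.
have ab := diff_blocks_neq ppP PB PC neBC Ba Cb.
(* The shift [t] must satisfy [4 - m^2 t = -(m-2)^2 t], that is, [4 (m-1) t = 4]. *)
apply: (@foulkes_decomposable_of_eigencol (fun Q => edge F Q a b - (m - 1)^-1)
  ((m - 2) ^+ 2) P) indec => //.
- by rewrite /edge (negPf nPab) sub0r oppr_eq0 invr_eq0.
- rewrite -subr_eq0 (_ : _ - _ = 2 * 2 * (m - 1)); last by ring.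
  by rewrite !mulf_neq0.
- move=> Q ppQ; under eq_bigr do rewrite sumrB.
  by rewrite sumrB sum_ord2_const tperm_sum_edge // -/m; field; rewrite -natrM.
Qed.

(** For [m = 1] the difference of the two quadratic terms is scaled by [9 - 4 = 5], the [x_ad x_bc]
    terms cancelling, and leaves 4 times the linear part. The linear part itself has eigenvalue 1,
    so it too ends up scaled by 5. *)
Lemma foulkes_decomposable_special :
  (2 < n)%N -> m = 1 -> ~ mx_indecomposable (foulkes_repr F n).
Proof.
move=> n_gt2 m1 indec; case: (indec) => /card_gt0P[P ppP] _.
(* With [ab] a block and [c], [d] in two further blocks, only [x_ab] survives and [h P = 1]. On four
   points [h] would take only the values 3, -3 and 0, all zero when [m = 4 = 1]. *)
have /card_gt2P[A [B [C [[PA PB PC] [neAB neBC neCA]]]]] : (2 < #|P|)%N.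
  by rewrite (card_pair_partition ppP).
have neAC : A != C by rewrite eq_sym.
have /eqP/cards2P[a [b [ab eA]]] := card_block ppP PA.
have /card_gt0P[c Bc] : (0 < #|B|)%N by rewrite (card_block ppP PB).
have /card_gt0P[d Cd] : (0 < #|C|)%N by rewrite (card_block ppP PC).
have Aa : a \in A by rewrite eA set21.
have Ab : b \in A by rewrite eA set22.
have ac := diff_blocks_neq ppP PA PB neAB Aa Bc.
have bc := diff_blocks_neq ppP PA PB neAB Ab Bc.
have ad := diff_blocks_neq ppP PA PC neAC Aa Cd.
have bd := diff_blocks_neq ppP PA PC neAC Ab Cd.
have cd := diff_blocks_neq ppP PB PC neBC Bc Cd.
pose h Q := edge F Q a b * edge F Q c d - edge F Q a c * edge F Q b d
  + (edge F Q a b + edge F Q c d - edge F Q a c - edge F Q b d).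
apply: (@foulkes_decomposable_of_eigencol h 5 P) indec => //.
- rewrite /h /edge -eA PA (negPf (edge_diff_blocks ppP PB PC neBC Bc Cd)).
  rewrite (negPf (edge_diff_blocks ppP PA PB neAB Aa Bc)).
  rewrite (negPf (edge_diff_blocks ppP PA PC neAC Ab Cd)).
  by rewrite !(mulr0, mul0r, subr0, oppr0, addr0, add0r); apply: oner_neq0.
- rewrite m1 -subr_eq0 (_ : _ - _ = - (2 * 2)); last by ring.
  by rewrite oppr_eq0 mulf_neq0.
- move=> Q ppQ; rewrite /h.
  under eq_bigr do rewrite !(big_split, sumrN) /=.
  rewrite !(big_split, sumrN) /=.
  rewrite !tperm_sum_edge // !tperm_sum_edge2 //=.
  + by rewrite -/m m1 (edgeC _ Q c b); ring.
  + by rewrite !inE !negb_or ac ab ad bd cd eq_sym bc.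
  + by rewrite !inE !negb_or ac ab ad bd cd bc.
Qed.

End FoulkesDecomposable.

(** * The cases of at most one pair *)

(** There is at most one matching: the empty one for [n = 0], the single full block for [n = 1]. *)
Lemma foulkes_le1_trivial (F : fieldType) n :
  (0 < #|pair_partitions n|)%N -> (n <= 1)%N -> mx_trivial (foulkes_repr F n).
Proof.
move=> pp_gt0 n_le1; apply: permmod_trivial; apply/eqP; rewrite eqn_leq pp_gt0 andbT.
apply/card_le1_eqP=> P Q ppP ppQ.
have [cP cQ] := (card_pair_partition ppP, card_pair_partition ppQ).
have coverT R : R \in pair_partitions n -> cover R = [set: _].
  by rewrite inE => /and3P[/cover_partition].
case: n => [|[|//]] in P Q ppP ppQ cP cQ coverT n_le1 pp_gt0 *.
  by rewrite (cards0_eq cP) (cards0_eq cQ).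
have single R : R \in pair_partitions 1 -> R = [set [set: _]].
  move=> ppR; have /eqP/cards1P[B eR] := card_pair_partition ppR.
  by rewrite -(coverT R) // eR /cover big_set1.
by rewrite (single P) // (single Q).
Qed.

(** * The three matchings of four points, and characteristic 3 *)

Section FourPoints.

Let o0 : 'I_(2 * 2) := @Ordinal (2 * 2) 0 isT.
Let o1 : 'I_(2 * 2) := @Ordinal (2 * 2) 1 isT.
Let o2 : 'I_(2 * 2) := @Ordinal (2 * 2) 2 isT.
Let o3 : 'I_(2 * 2) := @Ordinal (2 * 2) 3 isT.

(** A matching of four points is determined by the partner [k] of [o0]. For [k = o0] the value is
    not a matching. *)
Definition pair_partition_of (k : 'I_(2 * 2)) : {set {set 'I_(2 * 2)}} :=
  [set [set o0; k]; ~: [set o0; k]].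

Lemma pair_partition_ofP k :
  o0 != k -> pair_partition_of k \in pair_partitions 2.
Proof.
move=> nz_k; have cE : #|[set o0; k]| = 2%N by rewrite cards2 nz_k.
have cEC : #|~: [set o0; k]| = 2%N by rewrite cardsCs setCK cE card_ord.
have neE : [set o0; k] != ~: [set o0; k].
  by apply/eqP=> /setP/(_ o0); rewrite !inE eqxx.
have pE : partition (pair_partition_of k) [set: 'I_(2 * 2)].
  apply/and3P; split.
  - by rewrite /cover bigcup_setU !big_set1 setUCr.
  - apply/trivIsetP=> A B /set2P[]-> /set2P[]->; rewrite ?eqxx // => _.
      by rewrite disjoints_subset setCK.
    by rewrite disjoints_subset.
  - by apply/negP=> /set2P[] e; [move: cE | move: cEC]; rewrite -e cards0.
rewrite inE pE cards2 neE eqxx; apply/forall_inP=> _ /set2P[]->.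
  by rewrite cE.
by rewrite cEC.
Qed.

Lemma pair_partition_of_edge P k :
  P \in pair_partitions 2 -> [set o0; k] \in P -> P = pair_partition_of k.
Proof.
move=> ppP Pk; apply/esym/eqP; rewrite eqEcard (card_pair_partition ppP).
have nz_k : o0 != k by apply: contraTneq Pk => <-; apply: (edge_diag ppP).
rewrite (card_pair_partition (pair_partition_ofP nz_k)) leqnn andbT.
have /card_gt1P[A [B [PA PB neAB]]] : (1 < #|P|)%N by rewrite (card_pair_partition ppP).
have [C PC neC] : exists2 C, C \in P & C != [set o0; k].
  by have [eA | ] := eqVneq A [set o0; k]; [exists B; rewrite // eq_sym -eA | exists A].
suffices eC : C = ~: [set o0; k] by apply/subsetP=> _ /set2P[]->; rewrite -?eC.
apply/eqP; rewrite eqEcard (card_block ppP PC) cardsCs setCK cards2 nz_k card_ord andbT.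
apply/subsetP=> x Cx; rewrite inE; apply/negP=> kx.
by have := diff_blocks_neq ppP PC Pk neC Cx kx; rewrite eqxx.
Qed.

(** The 3-cycle sending [o1] to [o2], [o2] to [o3] and [o3] to [o1]; it fixes [o0] and so rotates
    its possible partners. *)
Let g : 'S_(2 * 2) := (tperm o1 o2 * tperm o1 o3)%g.

Lemma cycle3_cube : (g * g * g = 1)%g.
Proof.
apply/permP=> -[[|[|[|[|k]]]] lt_k4] //; apply: val_inj; by rewrite !permM !permE.
Qed.

Lemma cycle3_act k : o0 != k ->
  set_of_sets_action 2 (pair_partition_of k) g = pair_partition_of (g k).
Proof.
move=> nz_k; apply: pair_partition_of_edge.
  by rewrite (acts_act (pair_partitions_acts 2) (in_setT g)) // pair_partition_ofP.
rewrite edge_act permK (_ : g^-1%g o0 = o0) ?set21 //.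
by apply: (@perm_inj _ g); rewrite permKV; apply: val_inj; rewrite !permM !permE.
Qed.

(** Transitivity of the powers of [g] on the three matchings, in the form of an induction
    principle. *)
Lemma pair_partition2_ind (Q : {set {set 'I_(2 * 2)}} -> Prop) :
    Q (pair_partition_of o1) ->
    (forall P, P \in pair_partitions 2 -> Q P -> Q (set_of_sets_action 2 P g)) ->
  forall P, P \in pair_partitions 2 -> Q P.
Proof.
move=> Q1 Qg P ppP.
have [k nz_k /(pair_partition_of_edge ppP)->] := pair_partition_partner ppP o0.
have e12 : g o1 = o2 by apply: val_inj; rewrite !permM !permE.
have e23 : g o2 = o3 by apply: val_inj; rewrite !permM !permE.
have Q2 : Q (pair_partition_of o2).
  by rewrite -e12 -cycle3_act //; apply: Qg; rewrite ?pair_partition_ofP.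
have Q3 : Q (pair_partition_of o3).
  by rewrite -e23 -cycle3_act //; apply: Qg; rewrite ?pair_partition_ofP.
case: k nz_k => -[|[|[|[|k]]]] lt_k4 // _.
- by rewrite (_ : Ordinal _ = o1) //; apply: val_inj.
- by rewrite (_ : Ordinal _ = o2) //; apply: val_inj.
- by rewrite (_ : Ordinal _ = o3) //; apply: val_inj.
Qed.

Variable F : fieldType.

Lemma foulkes2_fixed_const (u : 'rV[F]_#|pair_partitions 2|) :
  u *m foulkes_repr F 2 g = u -> exists c, u = const_mx c.
Proof.
move=> ug; have pp1 : pair_partition_of o1 \in pair_partitions 2.
  exact: pair_partition_ofP.
pose v P := u 0 (enum_rank_in pp1 P); exists (v (pair_partition_of o1)).
apply/rowP=> i; rewrite mxE; transitivity (v (enum_val i)).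
  by rewrite /v enum_valK_in.
apply: (pair_partition2_ind (Q := fun P => v P = _)) (enum_valP i) => // P ppP <-.
have ppPg : set_of_sets_action 2 P g \in pair_partitions 2.
  by rewrite (acts_act (pair_partitions_acts 2) (in_setT g)).
by rewrite /v -{1}ug; apply: permmod_row; rewrite !enum_rankK_in.
Qed.

Hypothesis charF3 : 3%N \in [pchar F].

(* g acts unipotently, since (g - 1)^3 = g^3 - 1 = 0 in characteristic 3. *)
Lemma foulkes2_submodule_const (U : 'M[F]_#|pair_partitions 2|) :
  mxmodule (foulkes_repr F 2) U -> U != 0 ->
  ((const_mx 1 : 'rV[F]_#|pair_partitions 2|) <= U)%MS.
Proof.
move=> /mxmoduleP modU /rowV0Pn[u uU nz_u].
have Vg (v : 'rV_ _) : (v <= U)%MS -> (v *m foulkes_repr F 2 g <= U)%MS.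
  by move=> vU; apply: submx_trans (modU g _); rewrite ?submxMr ?inE.
have [w wU [nz_w wg]] : exists2 w : 'rV_ _, (w <= U)%MS
    & w != 0 /\ w *m foulkes_repr F 2 g = w.
  pose N (v : 'rV_ _) := v *m foulkes_repr F 2 g - v.
  have NU v : (v <= U)%MS -> (N v <= U)%MS.
    by move=> vU; rewrite addmx_sub ?eqmx_opp // Vg.
  have N3 v : N (N (N v)) = 0.
    rewrite /N !mulmxBl; set b := v *m _; set c := b *m _.
    have -> : c *m foulkes_repr F 2 g = v.
      by rewrite /c /b -!mulmxA -!repr_mxM ?inE // mulgA cycle3_cube repr_mx1 mulmx1.
    clearbody c; clearbody b; apply/rowP=> i; rewrite !mxE.
    have three0 : 3 = 0 :> F by rewrite (pcharf0 charF3).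
    by transitivity (3 * (b 0 i - c 0 i)); [ring | rewrite three0 mul0r].
  have fixN v : N v = 0 -> v *m foulkes_repr F 2 g = v.
    by move/eqP; rewrite subr_eq0 => /eqP.
  (* The last nonzero vector among [u], [N u], [N (N u)] is killed by [N], hence fixed by [g]. *)
  have [Nu0 | nz_Nu] := eqVneq (N u) 0; first by exists u; auto.
  have [NNu0 | nz_NNu] := eqVneq (N (N u)) 0; first by exists (N u); auto.
  by exists (N (N u)); auto.
have [c ew] := foulkes2_fixed_const wg.
have nz_c : c != 0.
  by apply: contraNneq nz_w => c0; rewrite ew c0; apply/eqP/rowP=> i; rewrite !mxE.
rewrite (_ : const_mx 1 = c^-1 *: w) ?scalemx_sub //.
by apply/rowP=> i; rewrite ew !mxE mulVf.
Qed.

(** Two nonzero submodules share the all-ones row, so they cannot intersect in zero. *)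
Lemma foulkes2_indecomposable : mx_indecomposable (foulkes_repr F 2).
Proof.
have pp1 : pair_partition_of o1 \in pair_partitions 2 by apply: pair_partition_ofP.
split=> [|U V modU modV _ capUV0]; first by apply/card_gt0P; exists (pair_partition_of o1).
have [-> | nzU] := eqVneq U 0; first by left.
have [-> | nzV] := eqVneq V 0; first by right.
have : ((const_mx 1 : 'rV[F]_#|pair_partitions 2|) <= U :&: V)%MS.
  by rewrite sub_capmx !foulkes2_submodule_const.
rewrite capUV0 submx0 => /eqP/rowP/(_ (enum_rank_in pp1 (pair_partition_of o1))).
by rewrite !mxE => /eqP; rewrite oner_eq0.
Qed.

(** The trivial module has dimension 1, but there are at least two matchings. *)
Lemma foulkes2_nontrivial : ~ mx_trivial (foulkes_repr F 2).
Proof.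
move=> /mxrank_rsim card1.
have [pp1 pp2] : pair_partition_of o1 \in pair_partitions 2
    /\ pair_partition_of o2 \in pair_partitions 2 by split; apply: pair_partition_ofP.
suffices : (1 < #|pair_partitions 2|)%N by rewrite card1.
apply/card_gt1P; exists (pair_partition_of o1), (pair_partition_of o2).
split=> //; apply/eqP=> e12.
have o1P : [set o0; o1] \in pair_partition_of o1 by rewrite set21.
have o2P : [set o0; o2] \in pair_partition_of o1 by rewrite e12 set21.
by have := edge_inj pp1 o1P o2P.
Qed.

End FourPoints.

(* Combining the cases *)
Local Close Scope ring_scope.

Theorem corollary1p5 (p : nat) (hp : prime p) (hodd : odd p)
    (F : fieldType) (hF : p \in [pchar F]%R) (n : nat) :
  (mx_indecomposable (foulkes_repr F n) /\ ~ mx_trivial (foulkes_repr F n))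
  <-> (n = 2 /\ p = 3).
Proof.
split=> [[indec nontriv] | [-> p3]]; last first.
  rewrite p3 in hF.
  by split; [apply: foulkes2_indecomposable | apply: foulkes2_nontrivial].
have two_neq0 : (2%:R != 0 :> F)%R.
  rewrite -(dvdn_pcharf hF) dvdn_prime2 //.
  by apply: contraTneq hodd => ->.
have n_gt1 : 1 < n.
  rewrite ltnNge; apply/negP=> n_le1; case: nontriv.
  by apply: foulkes_le1_trivial => //; case: indec.
have m1 : ((2 * n)%:R = 1 :> F)%R.
  apply/eqP; rewrite -GRing.subr_eq0; apply/negPn/negP=> nz_m1.
  exact: foulkes_decomposable_generic indec.
have n2 : n = 2.
  apply/eqP; rewrite eqn_leq n_gt1 andbT leqNgt; apply/negP=> n_gt2.
  exact: foulkes_decomposable_special indec.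
split=> //; apply/eqP; rewrite -dvdn_prime2 // (dvdn_pcharf hF).
(* For [n = 2], [m = 1] says [4 = 1] in [F]; hence [3 = 0] and [p] divides 3. *)
apply/eqP/(GRing.addIr 1%R).
by rewrite GRing.natr1 GRing.add0r -[RHS]m1 n2.
Qed.
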